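(* Let $G=(V,E)$ be a finite connected quasi-threshold graph with adjacency matrix $A$. Then $G$ is globally synchronizing: every second-order stationary point $\boldsymbol{\theta}\in\mathbb{R}^{V}$ of the energy \[ E_G(\boldsymbol{\theta})=\frac12\sum_{i,j\in V}A_{ij}\bigl(1-\cos(\theta_i-\theta_j)\bigr) \] is a synchronized state, i.e. $\theta_i\equiv\theta_j \pmod{2\pi}$ for all $i,j\in V$.
   Context: A quasi-threshold (trivially perfect) graph is a graph containing no induced path on four vertices and no induced cycle on four vertices; equivalently, a connected quasi-threshold graph is the comparability graph of a rooted tree (vertices are the tree's vertices, two vertices adjacent iff one is a proper ancestor of the other). A second-order stationary point of $E_G$ is a point $\boldsymbol{\theta}$ with $\nabla E_G(\boldsymbol{\theta})=0$ and $\nabla^2E_G(\boldsymbol{\theta})$ positive semidefinite. *)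

(* Defs.v *)
From mathcomp Require Import all_boot all_order all_algebra.
From mathcomp Require Import all_classical all_reals all_analysis.

Set Implicit Arguments.
Unset Strict Implicit.
Unset Printing Implicit Defensive.

Import Order.TTheory GRing.Theory Num.Theory.
Import numFieldNormedType.Exports.

Local Open Scope ring_scope.

Definition simple_graph (V : finType) (e : rel V) : Prop :=
  symmetric e /\ irreflexive e.

Definition connected_graph (V : finType) (e : rel V) : Prop :=
  forall x y : V, fingraph.connect e x y.

Definition path_graph (n : nat) : rel 'I_n :=
  fun a b => (a.+1 == b :> nat) || (b.+1 == a :> nat).

(* A simple graph only for [n >= 3]. *)
Definition cycle_graph (n : nat) : rel 'I_n :=
  fun a b => (a.+1 %% n == b)%N || (b.+1 %% n == a)%N.

Definition has_induced (U V : finType) (h : rel U) (e : rel V) : Prop :=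
  exists f : U -> V, injective f /\ forall a b : U, e (f a) (f b) = h a b.

Definition quasi_threshold (V : finType) (e : rel V) : Prop :=
  ~ has_induced (@path_graph 4) e /\ ~ has_induced (@cycle_graph 4) e.

(* Points of R^V are functions [V -> R]. [partial i f x] is the derivative at
   [x i] of [f] as a function of its [i]-th coordinate. Like [derive1], it is
   total; it is only used for the energy, which is smooth. *)
Definition partial (R : realType) (V : finType) (i : V)
    (f : (V -> R) -> R) (x : V -> R) : R :=
  (fun t : R => f (fun j => if j == i then t else x j))^`()%classic (x i).

Definition gradient (R : realType) (V : finType)
    (f : (V -> R) -> R) (x : V -> R) : V -> R :=
  fun i => partial i f x.

Definition hessian (R : realType) (V : finType)
    (f : (V -> R) -> R) (x : V -> R) : V -> V -> R :=
  fun i j => partial i (partial j f) x.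

(* Symmetry of [M] is not included: it is automatic for the Hessian of a
   smooth function. *)
Definition pos_semidef (R : realType) (V : finType) (M : V -> V -> R) : Prop :=
  forall u : V -> R, 0 <= \sum_(i : V) \sum_(j : V) u i * M i j * u j.

Definition second_order_stationary (R : realType) (V : finType)
    (f : (V -> R) -> R) (x : V -> R) : Prop :=
  (forall i : V, gradient f x i = 0) /\ pos_semidef (hessian f x).

Definition adjacency (R : realType) (V : finType) (e : rel V) : V -> V -> R :=
  fun i j => (e i j)%:R.

Definition energy (R : realType) (V : finType) (e : rel V) (theta : V -> R) : R :=
  2^-1 * \sum_(i : V) \sum_(j : V)
           adjacency R e i j * (1 - cos (theta i - theta j)).

Definition synchronized (R : realType) (V : finType) (theta : V -> R) : Prop :=
  forall i j : V, exists k : int, theta i - theta j = k%:~R * (2 * pi).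

Definition globally_synchronizing (R : realType) (V : finType) (e : rel V) : Prop :=
  forall theta : V -> R,
    second_order_stationary (energy e) theta -> synchronized theta.

(* Main.v *)
(* Write [z_i] for the unit complex number of argument [theta_i]. Let [S] be a
   vertex set whose vertices all receive the same field [P], the sum of [z_j]
   over the neighbours outside [S]. If [P <> 0], then [z_i = P / |P|] on all of
   [S], by induction on [#|S|]. An induced quasi-threshold graph either splits
   into mutually nonadjacent parts, which receive the same field [P], or has a
   dominating vertex [v]. Then [S :\ v] receives the field [P + z_v], so the
   induction hypothesis gives its direction if that field is nonzero;
   stationarity at [v] and positivity of the Hessian at the indicator functions
   of [v] and [S] exclude [P + z_v = 0] and force [z_v] to point along [P].
   A connected graph has a dominating vertex [v], and the complement of [v]
   receives the field [z_v], which is nonzero. *)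

Require Import Defs.
From mathcomp Require Import all_boot all_order all_algebra.
From mathcomp Require Import all_classical all_reals all_analysis.
From mathcomp Require Import fintype finset ring lra.

Set Implicit Arguments.
Unset Strict Implicit.
Unset Printing Implicit Defensive.

Import Order.TTheory GRing.Theory Num.Theory.
Import numFieldNormedType.Exports.

Local Open Scope ring_scope.

(** * Splitting quasi-threshold graphs *)

Lemma induced_P4_or_C4 (V : finType) (e : rel V) (c v a b : V) :
  symmetric e -> irreflexive e -> uniq [:: c; v; a; b] ->
  e c v -> e v a -> e a b -> e c a = false -> e v b = false ->
  ~ quasi_threshold e.
Proof.
move=> sym irr Uf cv va ab ca vb [noP noC].
pose f (i : 'I_4) := nth c [:: c; v; a; b] i.
have f_inj : injective f.
  by move=> i j /eqP; rewrite nth_uniq ?ltn_ord // => /eqP/val_inj.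
have vc : e v c by rewrite sym.
have av : e a v by rewrite sym.
have ba : e b a by rewrite sym.
have ac : e a c = false by rewrite sym.
have bv : e b v = false by rewrite sym.
(* Only the pair [c], [b] is undetermined: an edge closes an induced 4-cycle, a non-edge leaves an
   induced path. *)
case cb : (e c b); have bc := cb; rewrite sym in bc.
- apply: noC; exists f; split=> // -[[|[|[|[|i]]]] hi] // [[|[|[|[|j]]]] hj] //;
  by rewrite /f /cycle_graph /= ?irr ?cv ?va ?ab ?vc ?av ?ba ?ac ?bv ?ca ?vb ?cb ?bc.
- apply: noP; exists f; split=> // -[[|[|[|[|i]]]] hi] // [[|[|[|[|j]]]] hj] //;
  by rewrite /f /path_graph /= ?irr ?cv ?va ?ab ?vc ?av ?ba ?ac ?bv ?ca ?vb ?cb ?bc.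
Qed.

Lemma quasi_threshold_dominating_or_split (V : finType) (e : rel V)
    (S : {set V}) (x0 : V) :
  simple_graph e -> quasi_threshold e -> x0 \in S ->
  (exists2 v, v \in S & forall x, x \in S -> x != v -> e v x) \/
  (exists A : {set V}, [/\ A != set0, A \proper S &
     forall a b, a \in A -> b \in S -> b \notin A -> e a b = false]).
Proof.
move=> [sym irr] qt x0S.
(* A vertex [v] of maximal degree in [S]: an edge [a -- b] leaving its closed
   neighbourhood [N v] makes some [c] in [N v] nonadjacent to [a], and
   [c -- v -- a -- b] is then an induced path or cycle. *)
pose N v := [set x in S | (x == v) || e v x].
have [v vS vmax] : exists2 v, v \in S & forall w, w \in S -> (#|N w| <= #|N v|)%N.
  by have [v vS vmax] := arg_maxnP (fun v => #|N v|) x0S; exists v.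
have NS : N v \subset S by apply/subsetP=> x; rewrite inE => /andP[].
have vN : v \in N v by rewrite inE vS eqxx.
have [NvS|NvS] := eqVneq (N v) S.
  left; exists v => // x xS xv.
  by move: xS; rewrite -{1}NvS inE (negPf xv) => /andP[].
right; exists (N v); split.
- by apply/set0Pn; exists v.
- by rewrite properEneq NvS.
move=> a b aN bS bN; apply/negP=> ab.
have [bv vb] : b != v /\ e v b = false.
  by move: bN; rewrite inE bS /= negb_or => /andP[-> /negPf].
have aS : a \in S by move/subsetP: NS; apply.
have av : a != v by apply: contraFneq vb => <-.
have va : e v a by move: aN; rewrite inE aS (negPf av).
(* By maximality, inclusion would force [N v = N a], but [b] lies only in [N a]. *)
have /subsetPn[c cN cNa] : ~~ (N v \subset N a).
  apply/negP=> sub.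
  have eqN : N v = N a by apply/eqP; rewrite eqEcard sub; apply: vmax.
  by move: bN; rewrite eqN inE bS ab orbT.
have cS : c \in S by move/subsetP: NS; apply.
have [ca ac] : c != a /\ e a c = false.
  by move: cNa; rewrite inE cS /= negb_or => /andP[-> /negPf].
have cv : c != v by apply: contraFneq ac => ->; rewrite sym.
have vc : e v c by move: cN; rewrite inE cS (negPf cv).
have cb : c != b by apply: contraFneq ac => ->.
have ba : a != b by apply: contraTneq ab => ->; rewrite irr.
apply: (@induced_P4_or_C4 _ e c v a b) => //; try by rewrite sym.
by rewrite /= !inE !negb_or cv ca cb (eq_sym v a) av (eq_sym v b) bv ba.
Qed.

(** * Plane vectors at a dominating vertex *)

Lemma sqrt_norm_scaled (R : rcfType) (s x y : R) :
  0 <= s -> x ^+ 2 + y ^+ 2 = 1 ->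
  Num.sqrt ((s * x) ^+ 2 + (s * y) ^+ 2) = s.
Proof. by move=> s0 xy; rewrite !exprMn -mulrDr xy mulr1 sqrtr_sqr ger0_norm. Qed.

(* In complex notation, [z = (x, y)], [P = (p, q)] is the field created by the
   outside of a vertex set on each of its vertices, and [D] the field created
   on the dominating vertex [z] by the rest of the set. *)
Lemma aligned_with_field (R : realFieldType) (x y p q dx dy : R) :
  x ^+ 2 + y ^+ 2 = 1 ->
  y * (p + dx) - x * (q + dy) = 0 ->
  0 <= x * (p + dx) + y * (q + dy) ->
  0 <= p * (x + dx) + q * (y + dy) ->
  (p != 0) || (q != 0) ->
  ((p + x != 0) || (q + y != 0) ->
     exists2 m, 0 <= m & dx = m * (p + x) /\ dy = m * (q + y)) ->
  exists2 s, 0 < s & p = s * x /\ q = s * y.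
Proof.
move=> xy stat self cut P0 HD.
have [Q0|] := boolP ((p + x != 0) || (q + y != 0)); last first.
  rewrite negb_or !negbK => /andP[/eqP px /eqP qy].
  have ep : p = - x by lra.
  have eq : q = - y by lra.
  (* With [P = - z], [self] and [cut] bound the inner product of [z] and [D] below by [1] and above
     by [-1]. *)
  by exfalso; subst p q; lra.
have [m m0 [ex ey]] := HD Q0; pose l := x * (p + dx) + y * (q + dy).
(* Stationarity makes [P + D] parallel to the unit vector [z], so it equals [l z]. *)
have lx : p + dx = l * x.
  have -> : p + dx = (x ^+ 2 + y ^+ 2) * (p + dx) by rewrite xy mul1r.
  have -> : l * x = x ^+ 2 * (p + dx) + y * (x * (q + dy)) by rewrite /l; ring.
  have -> : x * (q + dy) = y * (p + dx) by lra.
  by ring.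
have ly : q + dy = l * y.
  have -> : q + dy = (x ^+ 2 + y ^+ 2) * (q + dy) by rewrite xy mul1r.
  have -> : l * y = x * (y * (p + dx)) + y ^+ 2 * (q + dy) by rewrite /l; ring.
  have -> : y * (p + dx) = x * (q + dy) by lra.
  by ring.
have m1 : 0 < 1 + m by lra.
(* Adding [z] to [P + D = l z], where [D = m (P + z)], gives [(1 + m) (P + z) = (l + 1) z], that is
   [P + z = u z]. *)
pose u := (l + 1) / (1 + m).
have l0 : 0 <= l by [].
have u0 : 0 < u by rewrite divr_gt0 //; lra.
have um : u * (1 + m) = l + 1 by rewrite divfK // gt_eqF.
have ep : p = (u - 1) * x.
  apply: (mulfI (lt0r_neq0 m1)).
  have -> : (1 + m) * ((u - 1) * x) = (u * (1 + m) - 1 - m) * x by ring.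
  by rewrite um; nra.
have eq : q = (u - 1) * y.
  apply: (mulfI (lt0r_neq0 m1)).
  have -> : (1 + m) * ((u - 1) * y) = (u * (1 + m) - 1 - m) * y by ring.
  by rewrite um; nra.
have u1 : u - 1 != 0.
  by apply: contraTneq P0; rewrite ep eq => ->; rewrite !mul0r eqxx.
(* Since [P = (u - 1) z] and [z + D = (1 + m u) z], [cut] bounds a product whose second factor is
   positive. *)
have cut' : 0 <= (u - 1) * (1 + m * u).
  have -> : (u - 1) * (1 + m * u) =
     (u - 1) * (1 + m * u) * (x ^+ 2 + y ^+ 2) by rewrite xy mulr1.
  suff <- : p * (x + dx) + q * (y + dy) =
     (u - 1) * (1 + m * u) * (x ^+ 2 + y ^+ 2) by [].
  by rewrite ex ey ep eq; ring.
have mu : 0 < 1 + m * u by have : 0 <= m * u by [rewrite mulr_ge0 // ltW]; lra.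
by exists (u - 1) => //; rewrite lt_def u1 -(pmulr_lge0 _ mu).
Qed.

(** * Induction over sets receiving a uniform field *)

Section Alignment.

(** The pair [(x i, y i)] stands for [z_i]; [stat] comes from the gradient, [cut] from the Hessian
    form at the indicator function of [S]. *)
Variables (R : realType) (V : finType) (e : rel V) (x y : V -> R).
Hypotheses (sg : simple_graph e) (qt : quasi_threshold e).
Hypothesis xy1 : forall i, x i ^+ 2 + y i ^+ 2 = 1.
Hypothesis stat :
  forall i, \sum_j (e i j)%:R * (y i * x j - x i * y j) = 0 :> R.
Hypothesis cut : forall S : {set V},
  0 <= \sum_(i in S) \sum_(j | j \notin S) (e i j)%:R * (x i * x j + y i * y j).

Lemma sum_nbr_dominating (S : {set V}) v (f : V -> R) :
  v \in S -> (forall z, z \in S -> z != v -> e v z) ->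
  \sum_j (e v j)%:R * f j =
  \sum_(j | j \notin S) (e v j)%:R * f j + \sum_(j in S :\ v) f j.
Proof.
move=> vS dom; rewrite (bigID (mem S)) /= addrC; congr (_ + _).
rewrite (big_setD1 v) //= (proj2 sg) mul0r add0r.
by apply: eq_bigr => z /setD1P[zv zS]; rewrite dom // mul1r.
Qed.

Lemma sum_nbr_setD1 (S : {set V}) v i (f : V -> R) : v \in S -> e v i ->
  \sum_(j | j \notin S :\ v) (e i j)%:R * f j =
  \sum_(j | j \notin S) (e i j)%:R * f j + f v.
Proof.
move=> vS vi; rewrite (bigD1 v) /= ?setD11 // addrC.
rewrite (proj1 sg) vi mul1r; congr (_ + _); apply: eq_bigl => j.
by rewrite !inE negb_and negbK; case: eqVneq => [->|]; rewrite /= ?vS ?andbT.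
Qed.

Lemma sum_nbr_split (S A : {set V}) i (f : V -> R) :
  A \subset S -> (forall b, b \in S -> b \notin A -> e i b = false) ->
  \sum_(j | j \notin A) (e i j)%:R * f j =
  \sum_(j | j \notin S) (e i j)%:R * f j.
Proof.
move=> AS noE; rewrite (bigID (mem S)) /= big1 ?add0r.
  apply: eq_bigl => j; rewrite andbC; case: (boolP (j \in S)) => //= jS.
  by apply: contra jS; apply: (subsetP AS).
by move=> j /andP[jA jS]; rewrite noE // mul0r.
Qed.

(** The field varies along the induction: removing a dominating vertex [v] adds [z_v] to it, while
    restricting to one side of a split preserves it. *)
Lemma homogeneous_set_aligned (S : {set V}) (p q : R) :
  (p != 0) || (q != 0) ->
  (forall i, i \in S -> \sum_(j | j \notin S) (e i j)%:R * x j = p) ->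
  (forall i, i \in S -> \sum_(j | j \notin S) (e i j)%:R * y j = q) ->
  forall i, i \in S -> p = Num.sqrt (p ^+ 2 + q ^+ 2) * x i /\
                       q = Num.sqrt (p ^+ 2 + q ^+ 2) * y i.
Proof.
have [n] := ubnP #|S|; elim: n => // n IH in S p q *; rewrite ltnS => Sn.
move=> P0 Hp Hq i iS.
have [[v vS dom]|[A [A0 AS noE]]] :=
    quasi_threshold_dominating_or_split sg qt iS; last first.
  (* A split is symmetric, so [A'] is whichever of [A] and [S :\: A] contains [i]. *)
  have [A' ltA [iA noE']] : exists2 A' : {set V}, A' \proper S & i \in A' /\
      forall a b, a \in A' -> b \in S -> b \notin A' -> e a b = false.
    have [iA|iA] := boolP (i \in A); first by exists A => //; split.
    exists (S :\: A).
      rewrite properEneq subsetDl andbT; apply: contraNneq A0 => SA.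
      rewrite -subset0; apply/subsetP=> z zA.
      have := subsetP (proper_sub AS) _ zA.
      by rewrite -SA inE zA.
    split; first by rewrite inE iA.
    move=> a b /setDP[aS aA] bS; rewrite inE bS andbT negbK => bA.
    by rewrite (proj1 sg) noE.
  have sA := proper_sub ltA.
  apply: (IH A') => //; first exact: leq_trans (proper_card ltA) Sn.
  - move=> a aA; rewrite (sum_nbr_split _ sA) ?Hp ?(subsetP sA) // => b.
    exact: noE'.
  - move=> a aA; rewrite (sum_nbr_split _ sA) ?Hq ?(subsetP sA) // => b.
    exact: noE'.
set T := S :\ v.
pose rQ := Num.sqrt ((p + x v) ^+ 2 + (q + y v) ^+ 2).
have IHT : (p + x v != 0) || (q + y v != 0) -> forall j, j \in T ->
    p + x v = rQ * x j /\ q + y v = rQ * y j.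
  move=> Q0; apply: IH => //.
  - by apply: leq_trans Sn; rewrite (cardsD1 v S) vS.
  - by move=> j /setD1P[jv jS]; rewrite (sum_nbr_setD1 _ vS) ?Hp ?dom.
  - by move=> j /setD1P[jv jS]; rewrite (sum_nbr_setD1 _ vS) ?Hq ?dom.
pose dx := \sum_(j in T) x j; pose dy := \sum_(j in T) y j.
have fx := sum_nbr_dominating x vS dom; rewrite Hp // -/T -/dx in fx.
have fy := sum_nbr_dominating y vS dom; rewrite Hq // -/T -/dy in fy.
have Hv : exists2 s, 0 < s & p = s * x v /\ q = s * y v.
  apply: (@aligned_with_field _ (x v) (y v) p q dx dy) => //.
  - rewrite -fx -fy -[RHS](stat v) !mulr_sumr -sumrB; apply: eq_bigr => j _.
    by ring.
  (* This cut is the inner product of [z_v] with its whole field [P + D]. *)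
  - have := cut [set v]; rewrite big_set1.
    suff -> : \sum_(j | j \notin [set v]) (e v j)%:R * (x v * x j + y v * y j) =
       x v * (p + dx) + y v * (q + dy) by [].
    rewrite -fx -fy !mulr_sumr -big_split /= [RHS](bigD1 v) //= (proj2 sg).
    rewrite !mul0r !mulr0 !add0r; apply: eq_big => [j|j _]; first by rewrite inE.
    by ring.
  (* Each [i] in [S] contributes the inner product of [P] with [z_i]; the [z_i] sum to [z_v + D]. *)
  - have := cut S; rewrite (eq_bigr (fun i => p * x i + q * y i)).
      by rewrite big_split /= -!mulr_sumr !(big_setD1 v vS).
    move=> j jS; rewrite -(Hp _ jS) -(Hq _ jS) !mulr_suml -big_split /=.
    by apply: eq_bigr => k _; ring.
  - move=> Q0.
    have rQ0 : 0 < rQ.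
      rewrite sqrtr_gt0; case/orP: Q0 => ?.
        by rewrite ltr_wpDr ?sqr_ge0 // exprn_even_gt0.
      by rewrite ltr_wpDl ?sqr_ge0 // exprn_even_gt0.
    (* Each of the [#|T|] vectors [z_j] summed in [D] equals [(P + z_v) / rQ]. *)
    exists (#|T|%:R / rQ); first by rewrite divr_ge0 // ltW.
    rewrite /dx /dy; split.
      rewrite (eq_bigr (fun=> (p + x v) / rQ)) => [|j /(IHT Q0)[-> _]].
        by rewrite sumr_const -mulr_natl; ring.
      by rewrite mulrC mulKf // gt_eqF.
    rewrite (eq_bigr (fun=> (q + y v) / rQ)) => [|j /(IHT Q0)[_ ->]].
      by rewrite sumr_const -mulr_natl; ring.
    by rewrite mulrC mulKf // gt_eqF.
have [s s0 [ps qs]] := Hv.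
have -> : Num.sqrt (p ^+ 2 + q ^+ 2) = s by rewrite ps qs sqrt_norm_scaled // ltW.
have [->//|iv] := eqVneq i v.
have iT : i \in T by rewrite !inE iv.
(* As [P + z_v = (s + 1) z_v] is nonzero, the induction hypothesis applies and gives [z_i = z_v]. *)
have ps1 : p + x v = (s + 1) * x v by rewrite ps; ring.
have qs1 : q + y v = (s + 1) * y v by rewrite qs; ring.
have s1 : 0 < s + 1 by rewrite addr_gt0.
have rQs : rQ = s + 1 by rewrite /rQ ps1 qs1 sqrt_norm_scaled // ltW.
have Q0 : (p + x v != 0) || (q + y v != 0).
  rewrite ps1 qs1 !mulf_eq0 !(gt_eqF s1) /= -negb_and; apply/negP.
  move=> /andP[/eqP x0 /eqP y0]; have /eqP := xy1 v.
  by rewrite x0 y0 expr0n addr0 eq_sym oner_eq0.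
have [] := IHT Q0 i iT; rewrite rQs ps1 qs1.
move=> /(mulfI (lt0r_neq0 s1)) <- /(mulfI (lt0r_neq0 s1)) <-.
by split.
Qed.

Lemma connected_aligned : connected_graph e ->
  forall i j, x i = x j /\ y i = y j.
Proof.
move=> conn i0 j0; have [sym irr] := sg.
have [[v _ dom]|[A [/set0Pn[a aA] AS noE]]] :=
    quasi_threshold_dominating_or_split sg qt (in_setT i0); last first.
  have [_ [b _ bA]] := properP AS.
  have closedA : fingraph.closed e (mem A).
    apply: (intro_closed (sym_connect_sym sym)) => c d cd cA.
    by apply: contraTT cd => dA; rewrite noE.
  by have := closed_connect closedA (conn a b); rewrite aA (negPf bA).
suff Hv i : x i = x v /\ y i = y v.
  by have [-> ->] := Hv i0; have [-> ->] := Hv j0.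
have [->//|iv] := eqVneq i v.
have z0 : (x v != 0) || (y v != 0).
  rewrite -negb_and; apply/negP=> /andP[/eqP x0 /eqP y0]; have /eqP := xy1 v.
  by rewrite x0 y0 expr0n addr0 eq_sym oner_eq0.
have fld (f : V -> R) j : j \in [set: V] :\ v ->
    \sum_(k | k \notin [set: V] :\ v) (e j k)%:R * f k = f v.
  move=> /setD1P[jv _]; rewrite (sum_nbr_setD1 _ (in_setT v)) ?dom //.
  by rewrite big_pred0 ?add0r // => k; rewrite inE.
have := @homogeneous_set_aligned _ _ _ z0 (fld x) (fld y) i.
rewrite !inE iv xy1 sqrtr1 !mul1r => /(_ isT)[-> ->].
by split.
Qed.

End Alignment.

(** * Gradient and Hessian of the energy *)

Section Derivatives.

Variables (R : realType) (V : finType).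

Lemma is_derive_bigsum (I : Type) (r : seq I) (f : I -> R -> R) (df : I -> R)
    (t : R) :
  (forall i, is_derive t 1 (f i) (df i)) ->
  is_derive t 1 (fun s => \sum_(i <- r) f i s) (\sum_(i <- r) df i).
Proof.
move=> fd; elim: r => [|i r IH].
  rewrite big_nil; under eq_fun do rewrite big_nil.
  exact: is_derive_cst.
rewrite big_cons; under eq_fun do rewrite big_cons.
exact: is_deriveD.
Qed.

(** General [c] and [g] allow two uses: with [1 - cos] for the gradient, then with [sin] for the
    Hessian, [c] absorbing the signs from the first derivative. *)
Lemma partial_pairwise (c : V -> V -> R) (g g' : R -> R) (i : V) (x : V -> R) :
  (forall t : R, is_derive t 1 g (g' t)) ->
  partial i (fun z => 2^-1 * \sum_a \sum_b c a b * g (z a - z b)) x =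
  2^-1 * \sum_a \sum_b c a b * ((a == i)%:R - (b == i)%:R) * g' (x a - x b).
Proof.
move=> gd; rewrite /partial derive1E; apply: derive_val.
pose z (t : R) j := if j == i then t else x j.
have zx j : z (x i) j = x j by rewrite /z; case: eqP => [->|].
have zd j : is_derive (x i) 1 (fun t => z t j) ((j == i)%:R).
  by rewrite /z; case: (j == i); [exact: is_derive_id | exact: is_derive_cst].
apply: is_deriveZ; apply: is_derive_bigsum => a; apply: is_derive_bigsum => b.
rewrite -mulrA; apply: is_deriveZ; rewrite mulrC.
by apply: (@is_derive1_comp _ g (fun t => z t a - z t b)); rewrite !zx.
Qed.

Variable e : rel V.

Lemma gradient_energy (x : V -> R) (i : V) :
  gradient (energy e) x i =
  2^-1 * \sum_a \sum_b
    adjacency R e a b * ((a == i)%:R - (b == i)%:R) * sin (x a - x b).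
Proof.
apply: (@partial_pairwise (adjacency R e) (fun t => 1 - cos t) sin) => t.
have := is_deriveB (is_derive_cst (1 : R) t (1 : R)) (is_derive_cos t).
by rewrite sub0r opprK.
Qed.

Lemma hessian_energy (x : V -> R) (i j : V) :
  hessian (energy e) x i j =
  2^-1 * \sum_a \sum_b
    adjacency R e a b * ((a == j)%:R - (b == j)%:R)
      * ((a == i)%:R - (b == i)%:R) * cos (x a - x b).
Proof.
rewrite /hessian.
have -> : partial j (energy e) = fun z : V -> R => 2^-1 * \sum_a \sum_b
    adjacency R e a b * ((a == j)%:R - (b == j)%:R) * sin (z a - z b).
  by apply/funext => z; exact: gradient_energy.
exact: partial_pairwise.
Qed.

Lemma sum_delta (u : V -> R) a : \sum_i u i * (a == i)%:R = u a.
Proof.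
rewrite (bigD1 a) //= eqxx mulr1 big1 ?addr0 // => i ia.
by rewrite eq_sym (negPf ia) mulr0.
Qed.

(** The Hessian is a graph Laplacian with edge weights [cos (x a - x b)]. *)
Lemma hessian_energy_form (x u : V -> R) :
  \sum_i \sum_j u i * hessian (energy e) x i j * u j =
  2^-1 * \sum_a \sum_b
    adjacency R e a b * cos (x a - x b) * (u a - u b) ^+ 2.
Proof.
have du a b : \sum_i u i * ((a == i)%:R - (b == i)%:R) = u a - u b.
  by rewrite -!sum_delta -sumrB; apply: eq_bigr => i _; ring.
pose G i j a b := 2^-1 * (adjacency R e a b * cos (x a - x b)
  * (u i * ((a == i)%:R - (b == i)%:R)) * (u j * ((a == j)%:R - (b == j)%:R))).
transitivity (\sum_i \sum_j \sum_a \sum_b G i j a b).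
  apply: eq_bigr => i _; apply: eq_bigr => j _.
  rewrite hessian_energy !mulr_sumr mulr_suml; apply: eq_bigr => a _.
  rewrite !mulr_sumr mulr_suml; apply: eq_bigr => b _.
  by rewrite /G; ring.
under eq_bigr do rewrite exchange_big.
rewrite exchange_big mulr_sumr; apply: eq_bigr => a _.
under eq_bigr do rewrite exchange_big.
rewrite exchange_big mulr_sumr; apply: eq_bigr => b _.
rewrite expr2 -(du a b) big_distrlr /= !mulr_sumr; apply: eq_bigr => i _.
by rewrite !mulr_sumr; apply: eq_bigr => j _; rewrite /G; ring.
Qed.

Hypothesis sym : symmetric e.

Lemma stationary_sin (x : V -> R) (i : V) : gradient (energy e) x i = 0 ->
  \sum_j (e i j)%:R * sin (x i - x j) = 0.
Proof.
rewrite gradient_energy => grad0; rewrite -[RHS]grad0.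
pose W a b : R := (e a b)%:R * sin (x a - x b).
(* By antisymmetry the terms with [a = i] and those with [b = i] contribute equally, cancelling
   [2^-1]. *)
have Wa a b : W a b = - W b a by rewrite /W sym -opprB sinN mulrN.
have -> : \sum_a \sum_b adjacency R e a b * ((a == i)%:R - (b == i)%:R)
    * sin (x a - x b) = \sum_b W i b - \sum_a W a i.
  have -> : \sum_b W i b = \sum_a \sum_b W a b * (a == i)%:R.
    rewrite exchange_big; apply: eq_bigr => b _.
    by under eq_bigr do rewrite eq_sym; rewrite (sum_delta (W^~ b)).
  have -> : \sum_a W a i = \sum_a \sum_b W a b * (b == i)%:R.
    apply: eq_bigr => a _.
    by under eq_bigr do rewrite eq_sym; rewrite (sum_delta (W a)).
  rewrite -sumrB; apply: eq_bigr => a _; rewrite -sumrB; apply: eq_bigr => b _.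
  by rewrite /W /adjacency; ring.
have -> : \sum_a W a i = - \sum_b W i b by rewrite -sumrN; apply: eq_bigr.
by rewrite opprK -mulr2n -[X in _ * X]mulr_natl mulKf // pnatr_eq0.
Qed.

(** For the indicator [u] of [S], [(u a - u b) ^+ 2] selects the pairs separated by [S], each in
    both orders, which cancels the half. *)
Lemma pos_semidef_cut (x : V -> R) (S : {set V}) :
  pos_semidef (hessian (energy e) x) ->
  0 <= \sum_(i in S) \sum_(j | j \notin S) (e i j)%:R * cos (x i - x j).
Proof.
pose W a b : R := (e a b)%:R * cos (x a - x b).
have Ws a b : W a b = W b a by rewrite /W sym -opprB cosN.
pose u a : R := (a \in S)%:R.
move=> /(_ u); rewrite hessian_energy_form.
suff -> : \sum_a \sum_b
    adjacency R e a b * cos (x a - x b) * (u a - u b) ^+ 2 =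
    2 * \sum_(i in S) \sum_(j | j \notin S) W i j by rewrite mulKf // pnatr_eq0.
have -> : \sum_(i in S) \sum_(j | j \notin S) W i j =
    \sum_a \sum_b W a b * u a * (1 - u b).
  rewrite big_mkcond; apply: eq_bigr => a _.
  rewrite /u; case: (a \in S); last by rewrite big1 // => b _; rewrite mulr0 mul0r.
  rewrite big_mkcond; apply: eq_bigr => b _.
  by rewrite mulr1; case: (b \in S); rewrite /= ?subrr ?subr0 ?mulr0 ?mulr1.
rewrite mulr2n mulrDl mul1r [X in _ = _ + X]exchange_big -big_split /=.
apply: eq_bigr => a _; rewrite -big_split /=; apply: eq_bigr => b _.
rewrite (Ws b a) /W /adjacency /u.
by case: (a \in S); case: (b \in S); rewrite /=; ring.
Qed.

End Derivatives.

(** * Angles modulo [2 * pi], and the conclusion *)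

Lemma cosD2piz (R : realType) (k : int) (t : R) :
  cos (t + k%:~R * (2 * pi)) = cos t.
Proof.
rewrite (mulr_natl pi 2) mulrzl; case: k => n /=.
  exact: (periodicn (@cosD2pi R)).
by rewrite -[in RHS](subrK (pi *+ 2 *+ n.+1) t) (periodicn (@cosD2pi R)).
Qed.

(** Reduce [d] to [r] in [[0, 2 * pi)]: [cos r = 1] forces [sin (r / 2) = 0], but [sin] is positive
    on [(0, pi)], so [r = 0]. *)
Lemma cos_eq1 (R : realType) (d : R) :
  cos d = 1 -> exists k : int, d = k%:~R * (2 * pi).
Proof.
move=> cd; have pi2 : 0 < 2 * pi :> R by rewrite mulr_gt0 // pi_gt0.
pose k := Num.floor (d / (2 * pi)); exists k.
pose r := d - k%:~R * (2 * pi).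
have cr : cos r = 1 by rewrite -(cosD2piz k) subrK.
have /andP[r0 r2] : 0 <= r < 2 * pi.
  have /andP[] := floor_itv (d / (2 * pi)); rewrite -/k.
  rewrite ler_pdivlMr // ltr_pdivrMr // intrD mulrDl mul1r /r => ? ?.
  by apply/andP; split; lra.
have sr : sin (r / 2) = 0.
  have : cos (r / 2 *+ 2) = 1 by rewrite -mulr_natr divfK // pnatr_eq0.
  rewrite cos_mulr2n cos2sin2 => h; apply/eqP; rewrite -sqrf_eq0; apply/eqP.
  by lra.
have [r_gt0|r_le0] := ltP 0 r; last by rewrite /r in r0 r_le0 *; lra.
have : 0 < sin (r / 2) by apply: sin_gt0_pi; apply/andP; split; lra.
by rewrite sr ltxx.
Qed.

Theorem theorem1p1 (R : realType) (V : finType) (e : rel V) :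
  simple_graph e -> connected_graph e -> quasi_threshold e ->
  globally_synchronizing R e.
Proof.
move=> sg conn qt x [grad psd] i j; have sym := proj1 sg.
(* The cosine of the difference is the inner product of [z_i] and [z_j], which is [1] once these
   unit vectors agree. *)
apply: cos_eq1.
have [] := @connected_aligned R V e (fun i => cos (x i)) (fun i => sin (x i))
    sg qt _ _ _ conn i j.
- by move=> a; rewrite cos2Dsin2.
- move=> a; rewrite -[RHS](stationary_sin sym (grad a)).
  by apply: eq_bigr => b _; rewrite sinB; ring.
- move=> S; have := pos_semidef_cut sym S psd.
  by under eq_bigr do under eq_bigr do rewrite cosB.
by move=> ci si; rewrite cosB ci si -!expr2 cos2Dsin2.
Qed.
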